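(* Let $X$ be a shift space on a finite alphabet. The set of continuous roof functions $r\colon X\to(0,\infty)$ for which the suspension flow over $(X,\sigma)$ with roof function $r$ is not topologically mixing is dense, with respect to the supremum norm, in the set of all positive continuous real-valued functions on $X$.
   Context: Let $A$ be a finite alphabet. $A^{\mathbb{Z}}$ has the metric $d(x,y)=2^{-\min\{|n|: x_n\neq y_n\}}$ (and $d(x,x)=0$), and $\sigma$ is the left shift $(\sigma x)_n=x_{n+1}$. A shift space is a nonempty closed $\sigma$-invariant ($\sigma(X)=X$) set $X\subset A^{\mathbb{Z}}$. Suspension flow: given $r\colon X\to(0,\infty)$, let $M_r=\{(x,t)\in X\times[0,\infty): 0\le t\le r(x)\}/\sim$, with the quotient topology, where $(x,r(x))\sim(\sigma x,0)$. The suspension flow is $\varphi^T(x,s)=(\sigma^n x,s')$, where $n$ and $s'$ satisfy $\sum_{j=0}^{n-1}r(\sigma^jx)+s'=T+s$ and $0\le s'\le r(\sigma^nx)$. It is topologically mixing if for all nonempty open $U,V\subset M_r$ there is $T\in\mathbb{R}$ such that $\varphi^t(U)\cap V\neq\emptyset$ for all $t\ge T$. *)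

(* Defs.v *)
From Stdlib Require Import Relations.
From HB Require Import structures.
From mathcomp Require Import all_boot all_order all_algebra generic_quotient.
From mathcomp Require Import all_classical all_reals all_analysis.
From mathcomp Require Import zify lra.

Set Implicit Arguments.
Unset Strict Implicit.
Unset Printing Implicit Defensive.

Import Order.TTheory GRing.Theory Num.Theory.
Import numFieldNormedType.Exports.

Local Open Scope classical_set_scope.
Local Open Scope ring_scope.

(* The parameter R is phantom: it is the field in which the metric on A^Z takes
   its values, so that the metric can be inferred from the type. *)
Definition fullshift (R : realType) (A : finType) : Type := int -> A.

Section FullShift.
Context (R : realType) (A : finType).
Implicit Types x y z : fullshift R A.

HB.instance Definition _ := Choice.copy (fullshift R A) (int -> A).

Definition differ_at x y (m : nat) : bool :=
  `[< exists n : int, absz n = m /\ x n <> y n >].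

Definition shift_dist x y : R :=
  match pselect (exists m, differ_at x y m) with
  | left h => 2 ^- ex_minn h
  | right _ => 0
  end.

Lemma shift_dist_leP x y (m : nat) :
  shift_dist x y <= 2 ^- m <->
  forall n : int, (absz n < m)%N -> x n = y n.
Proof.
rewrite /shift_dist; case: pselect => [h|nh]; last first.
  split=> [_ n _|_]; last by rewrite invr_ge0 exprn_ge0.
  apply: contrapT => xy; apply: nh; exists (absz n).
  by apply/asboolP; exists n.
case: ex_minnP => k /asboolP[n [nk xyn]] kmin.
rewrite lef_pV2 ?posrE ?exprn_gt0// ler_eXn2l ?ltr1n//.
split=> [mk i im|H].
  apply: contrapT => xyi; have : differ_at x y (absz i) by apply/asboolP; exists i.
  by move/kmin => ki; move: (leq_ltn_trans (leq_trans mk ki) im); rewrite ltnn.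
by rewrite leqNgt; apply/negP => km; apply: xyn; apply: H; rewrite nk.
Qed.

Lemma shift_dist_cases x y :
  shift_dist x y = 0 \/ exists m, shift_dist x y = 2 ^- m.
Proof.
rewrite /shift_dist; case: pselect => [h|_]; last by left.
by right; exists (ex_minn h).
Qed.

Lemma shift_dist_ge0 x y : 0 <= shift_dist x y.
Proof.
by have [->//|[m ->]] := shift_dist_cases x y; rewrite invr_ge0 exprn_ge0.
Qed.

Lemma shift_dist0 x y : shift_dist x y = 0 -> x = y.
Proof.
move=> xy0; apply/funext => n.
apply: (proj1 (shift_dist_leP x y (absz n).+1)) => //.
by rewrite xy0 invr_ge0 exprn_ge0.
Qed.

Lemma shift_distxx x : shift_dist x x = 0.
Proof. by rewrite /shift_dist; case: pselect => // h; exfalso; case: h => m /asboolP[n []]. Qed.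

Lemma shift_dist_sym x y : shift_dist x y = shift_dist y x.
Proof.
suff H u v : shift_dist u v <= shift_dist v u.
  by apply/eqP; rewrite eq_le !H.
have [vu0|[m vum]] := shift_dist_cases v u.
  by rewrite (shift_dist0 vu0) shift_distxx.
rewrite vum; apply/shift_dist_leP => n nm; apply/esym.
by apply: (proj1 (shift_dist_leP v u m)) nm; rewrite vum.
Qed.

Lemma shift_dist_triangle y x z :
  shift_dist x z <= shift_dist x y + shift_dist y z.
Proof.
suff [|] : shift_dist x z <= shift_dist x y \/ shift_dist x z <= shift_dist y z.
- by move=> H; apply: le_trans H _; rewrite lerDl shift_dist_ge0.
- by move=> H; apply: le_trans H _; rewrite lerDr shift_dist_ge0.
have [xy0|[m xym]] := shift_dist_cases x y.
  by right; rewrite (shift_dist0 xy0).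
have [yz0|[k yzk]] := shift_dist_cases y z.
  by left; rewrite (shift_dist0 yz0).
have Hxy n : (absz n < m)%N -> x n = y n.
  by apply: (proj1 (shift_dist_leP x y m)); rewrite xym.
have Hyz n : (absz n < k)%N -> y n = z n.
  by apply: (proj1 (shift_dist_leP y z k)); rewrite yzk.
rewrite xym yzk.
have [mk|km] := leqP m k; [left|right]; apply/shift_dist_leP => n nm.
- by rewrite Hxy// Hyz//; apply: leq_trans mk.
- by rewrite Hxy ?Hyz//; apply: ltn_trans km.
Qed.

HB.instance Definition _ := @isMetric.Build R (fullshift R A) shift_dist
  shift_distxx shift_dist0 shift_dist_sym shift_dist_triangle.

(* The n-th iterate of the left shift, for n in Z. *)
Definition shift_iter (n : int) x : fullshift R A := fun k => x (k + n).

Definition shift x : fullshift R A := shift_iter 1 x.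

Lemma shift_iter0 x : shift_iter 0 x = x.
Proof. by apply/funext => k; rewrite /shift_iter addr0. Qed.

Lemma shift_iterD m n x : shift_iter (m + n) x = shift_iter m (shift_iter n x).
Proof. by apply/funext => k; rewrite /shift_iter addrA. Qed.

End FullShift.

Record shift_space (R : realType) (A : finType) := ShiftSpace {
  shift_set :> set (fullshift R A);
  shift_set_nonempty : shift_set !=set0;
  shift_set_closed : closed shift_set;
  shift_set_invariant : @shift R A @` shift_set = shift_set
}.

Section Suspension.
Context (R : realType) (A : finType) (X : shift_space R A).

Lemma shift_iter_in (n : int) (x : X) : shift_iter n (val x) \in shift_set X.
Proof.
have shiftP y : shift_set X y -> shift_set X (shift_iter 1 y).
  by move=> Xy; rewrite -shift_set_invariant; exists y.
have unshiftP y : shift_set X y -> shift_set X (shift_iter (- 1) y).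
  rewrite -{1}shift_set_invariant => -[z Xz <-].
  by rewrite /shift -shift_iterD addNr shift_iter0.
have Xx : shift_set X (val x) by apply: set_mem; exact: valP.
apply: mem_set; elim/int_rec: n => [|n IH|n IH].
- by rewrite shift_iter0.
- by rewrite intS shift_iterD; exact: shiftP.
- by rewrite intS opprD shift_iterD; exact: unshiftP.
Qed.

Definition sigma (n : int) (x : X) : X :=
  exist (fun y => y \in shift_set X) (shift_iter n (val x)) (shift_iter_in n x).

Lemma sigma0 x : sigma 0 x = x.
Proof. by apply/val_inj; exact: shift_iter0. Qed.

Lemma sigmaD m n x : sigma (m + n) x = sigma m (sigma n x).
Proof. by apply/val_inj; exact: shift_iterD. Qed.

Definition roof_function (r : X -> R) : Prop :=
  continuous r /\ forall x, 0 < r x.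

Context (r : X -> R).

Definition under_roof : set (X * R)%type :=
  [set p | 0 <= p.2 /\ p.2 <= r p.1].

(* (x, r x) is glued to (sigma x, 0) *)
Definition glue (a b : under_roof) : Prop :=
  (val a).2 = r (val a).1 /\ val b = (sigma 1 (val a).1, 0).

Definition glue_equiv (a b : under_roof) : bool :=
  `[< clos_refl_sym_trans _ glue a b >].

Lemma glue_equiv_refl : reflexive glue_equiv.
Proof. by move=> a; apply/asboolP; exact: rst_refl. Qed.

Lemma glue_equiv_sym : symmetric glue_equiv.
Proof. by move=> a b; apply/asboolP/asboolP; exact: rst_sym. Qed.

Lemma glue_equiv_trans : transitive glue_equiv.
Proof.
by move=> b a c /asboolP ab /asboolP bc; apply/asboolP; exact: rst_trans bc.
Qed.

Canonical glue_equiv_rel :=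
  EquivRel glue_equiv glue_equiv_refl glue_equiv_sym glue_equiv_trans.

Definition suspension : Type :=
  quotient_topology {eq_quot glue_equiv_rel}%qT.

HB.instance Definition _ := Topological.on suspension.
HB.instance Definition _ := Quotient.on suspension.

Definition susp_pi (a : under_roof) : suspension := (\pi_suspension a)%qT.

(* For n < 0 the sum from j = 0 to n - 1 is, as usual, minus the sum from
   j = n to -1. *)
Definition birkhoff_sum (n : int) (x : X) : R :=
  match n with
  | Posz m => \sum_(j < m) r (sigma j%:Z x)
  | Negz m => - \sum_(j < m.+1) r (sigma (- j.+1%:Z) x)
  end.

Definition flow_rel (T : R) (p q : suspension) : Prop :=
  exists (a b : under_roof) (n : int),
    [/\ p = susp_pi a, q = susp_pi b, (val b).1 = sigma n (val a).1 &
        birkhoff_sum n (val a).1 + (val b).2 = T + (val a).2].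

(* The point p is only a default value: see suspension_flowP. *)
Definition suspension_flow (T : R) (p : suspension) : suspension :=
  xget p [set q | flow_rel T p q].

Lemma birkhoff_sum0 x : birkhoff_sum 0 x = 0.
Proof. by rewrite /birkhoff_sum/= big_ord0. Qed.

Lemma birkhoff_sumS n x :
  birkhoff_sum (n + 1) x = birkhoff_sum n x + r (sigma n x).
Proof.
case: n => [m|[|m]].
- by rewrite -PoszD addn1 /birkhoff_sum big_ord_recr.
- by rewrite /= big_ord0 big_ord1 addNr.
- rewrite (_ : Negz m.+1 + 1 = Negz m) ?[in RHS]/birkhoff_sum; last by lia.
  by rewrite [in RHS]big_ord_recr/= opprD -addrA NegzE addNr addr0.
Qed.

Lemma birkhoff_sumSl n x :
  birkhoff_sum (n + 1) x = r x + birkhoff_sum n (sigma 1 x).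
Proof.
elim/int_rec: n => [|n IH|n IH].
- by rewrite birkhoff_sumS !birkhoff_sum0 sigma0 add0r addr0.
- rewrite (_ : n.+1%:Z = n%:Z + 1) 1?birkhoff_sumS ?[in RHS]birkhoff_sumS; last by lia.
  by rewrite IH -sigmaD addrA.
- have nE : - n%:Z = - n.+1%:Z + 1 by lia.
  move: IH; rewrite birkhoff_sumS nE !birkhoff_sumS -sigmaD.
  by lra.
Qed.

Hypothesis r_pos : forall x, 0 < r x.

Lemma birkhoff_sum_ltW x n m : n <= m -> birkhoff_sum n x <= birkhoff_sum m x.
Proof.
move=> nm; rewrite -(subrK n m) addrC -(gez0_abs (_ : 0 <= m - n)) ?subr_ge0//.
elim: `|m - n|%N => [|k IH]; first by rewrite addr0.
rewrite (_ : n + k.+1%:Z = n + k%:Z + 1) ?birkhoff_sumS; last by lia.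
by rewrite (le_trans IH)// lerDl ltW.
Qed.

Lemma birkhoff_sum_step x n m :
  n < m -> birkhoff_sum n x + r (sigma n x) <= birkhoff_sum m x.
Proof. by move=> nm; rewrite -birkhoff_sumS birkhoff_sum_ltW//; lia. Qed.

Lemma glue_equivP (a b : under_roof) :
  glue_equiv a b <-> [\/ a = b, glue a b | glue b a].
Proof.
split=> [/asboolP|[->|ab|ba]]; last 3 first.
- exact: glue_equiv_refl.
- by apply/asboolP; exact: rst_step.
- by rewrite glue_equiv_sym; apply/asboolP; exact: rst_step.
have glue_nz (u v w : under_roof) : glue u v -> glue v w -> False.
  by move=> [_ vE] [+ _]; rewrite vE/= => r0; move: (r_pos (sigma 1 (val u).1)); rewrite -r0 ltxx.
elim=> [u v uv|u|u v _ [->|uv|vu]|u v w _ [<-|uv|vu] _ [<-|vw|wv]].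
- by constructor 2.
- by constructor 1.
- by constructor 1.
- by constructor 3.
- by constructor 2.
- by constructor 1.
- by constructor 2.
- by constructor 3.
- by constructor 2.
- by case: (glue_nz _ _ _ uv vw).
- constructor 1; case: uv wv => uR uv [wR]; rewrite uv => /(congr1 fst)/= uw.
  have {}uw : (val u).1 = (val w).1.
    by rewrite -[LHS]sigma0 -[RHS]sigma0 -(addNr 1) !sigmaD uw.
  apply: val_inj; rewrite [LHS]surjective_pairing [RHS]surjective_pairing.
  by rewrite uR wR uw.
- by constructor 3.
- constructor 1; apply: val_inj.
  by case: vu vw => _ -> [_ ->].
- by case: (glue_nz _ _ _ wv vu).
Qed.

Lemma susp_piP (a b : under_roof) :
  susp_pi a = susp_pi b <-> [\/ a = b, glue a b | glue b a].
Proof.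
rewrite -glue_equivP -[glue_equiv a b](eqmodE glue_equiv_rel).
by split=> [ab|/eqP ab]; [apply/eqP; exact: ab|exact: ab].
Qed.

Lemma flow_rel_unique T p q q' : flow_rel T p q -> flow_rel T p q' -> q = q'.
Proof.
have same (x : X) (b b' : under_roof) n n' :
    (val b).1 = sigma n x -> (val b').1 = sigma n' x ->
    birkhoff_sum n x + (val b).2 = birkhoff_sum n' x + (val b').2 ->
    susp_pi b = susp_pi b'.
  wlog nn' : b b' n n' / n <= n'.
    move=> H bE b'E E; have [/H|/ltW/H] := leP n n'; first exact.
    by move=> H'; apply/esym/H'.
  have [b0 br] : under_roof (val b) by apply: set_mem; exact: valP.
  have [b'0 _] : under_roof (val b') by apply: set_mem; exact: valP.
  move: nn'; rewrite le_eqVlt => /predU1P[<-|nn'] bE b'E E.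
    congr susp_pi; apply: val_inj.
    rewrite [LHS]surjective_pairing [RHS]surjective_pairing bE b'E.
    by congr pair; lra.
  rewrite bE in br.
  have nE : n' = n + 1.
    apply/eqP; rewrite eq_sym; case: ltgtP => //; [|lia] => nn2.
    have := birkhoff_sum_step x nn2; rewrite birkhoff_sumS.
    by have := r_pos (sigma (n + 1) x); lra.
  apply/susp_piP; constructor 2; move: E b'E; rewrite nE birkhoff_sumS => E b'E.
  split; first by rewrite bE; lra.
  rewrite [LHS]surjective_pairing b'E bE addrC sigmaD; congr pair; lra.
have step a a' b n n' b' : glue a a' ->
    (val b).1 = sigma n (val a).1 ->
    birkhoff_sum n (val a).1 + (val b).2 = T + (val a).2 ->
    (val b').1 = sigma n' (val a').1 ->
    birkhoff_sum n' (val a').1 + (val b').2 = T + (val a').2 ->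
    susp_pi b = susp_pi b'.
  move=> [ar a'E] bE E; rewrite a'E/= -sigmaD => b'E E'.
  apply: (same (val a).1 _ _ n (n' + 1)) => //.
  by rewrite birkhoff_sumSl; lra.
move=> [a [b [n [-> -> bE E]]]] [a' [b' [n' [/susp_piP aa' -> b'E E']]]].
case: aa' => [aa'|aa'|a'a].
- by subst a'; apply: (same (val a).1 _ _ n n') => //; rewrite E.
- exact: (step a a' b n n' b').
- by apply/esym; exact: (step a' a b' n' n b).
Qed.

(* A continuous positive r has such a lower bound, X being compact. *)
Lemma flow_rel_exists c T p : 0 < c -> (forall x, c <= r x) ->
  exists q, flow_rel T p q.
Proof.
move=> c0 cr; pose a : under_roof := (repr p); pose x := (val a).1.
have pE : p = susp_pi a by rewrite /susp_pi reprK.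
pose u := T + (val a).2.
have lin k n : birkhoff_sum k x + c *+ n <= birkhoff_sum (k + n%:Z) x.
  elim: n => [|n IH]; first by rewrite mulr0n !addr0.
  rewrite (_ : k + n.+1%:Z = k + n%:Z + 1) ?birkhoff_sumS; last by lia.
  by have := cr (sigma (k + n%:Z) x); rewrite mulrS; lra.
have arch (v : R) : exists n, v <= c *+ n.
  exists (Num.bound `|v / c|); rewrite -mulr_natr mulrC -ler_pdivrMr//.
  by rewrite (le_trans (ler_norm _))// ltW// archi_boundP.
have [N HN] : exists N : nat, birkhoff_sum (- N%:Z) x <= u.
  have [N HN] := arch (- u); exists N; have := lin (- N%:Z) N.
  by rewrite addNr birkhoff_sum0; lra.
have ex : exists m : nat, u < birkhoff_sum (- N%:Z + m.+1%:Z) x.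
  have [m Hm] := arch (u - birkhoff_sum (- N%:Z) x); exists m.
  by have := lin (- N%:Z) m.+1; rewrite mulrS; lra.
case: (ex_minnP ex) => m um mmin.
pose n : int := - N%:Z + m%:Z.
have nu : birkhoff_sum n x <= u.
  rewrite /n; case: (m) mmin => [|k] kmin; first by rewrite addr0.
  by rewrite leNgt; apply/negP => /kmin; rewrite ltnn.
have un : u < birkhoff_sum n x + r (sigma n x).
  by rewrite -birkhoff_sumS /n -addrA -PoszD addn1.
have Hb : (sigma n x, u - birkhoff_sum n x) \in under_roof.
  by apply: mem_set; split => /=; lra.
exists (susp_pi (exist (fun p => p \in under_roof) _ Hb)), a, (exist (fun p => p \in under_roof) _ Hb), n.
by split=> //=; rewrite addrC subrK.
Qed.

Lemma suspension_flowP c T p q : 0 < c -> (forall x, c <= r x) ->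
  suspension_flow T p = q <-> flow_rel T p q.
Proof.
move=> c0 cr; have [q0 Hq0] := flow_rel_exists T p c0 cr.
have H : flow_rel T p (suspension_flow T p).
  by rewrite /suspension_flow; case: xgetP => [y _ //|/(_ q0)].
by split=> [<-//|]; exact: flow_rel_unique.
Qed.

End Suspension.

Definition topologically_mixing (R : realType) (M : topologicalType)
    (phi : R -> M -> M) : Prop :=
  forall U V : set M, open U -> U !=set0 -> open V -> V !=set0 ->
    exists T : R, forall t : R, T <= t -> (phi t @` U) `&` V !=set0.

(* sup returns 0 on unbounded sets; this is only meant for bounded f, such as a
   continuous function on the compact space X. *)
Definition sup_norm (R : realType) (T : Type) (f : T -> R) : R :=
  sup (range (fun x => `|f x|)).

Definition sup_dense (R : realType) (T : Type) (N P : set (T -> R)) : Prop :=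
  N `<=` P /\
  forall f, P f -> forall e : R, 0 < e ->
    exists2 g, N g & sup_norm (f \- g) < e.

(* Main.v *)
Require Import Defs.
From mathcomp Require Import all_boot all_order all_algebra.
From mathcomp Require Import all_classical all_reals all_analysis.
From mathcomp Require Import zify ring lra.
Local Open Scope classical_set_scope.

(** A continuous roof function on the compact space [X] is uniformly close to
    one which is locally constant with values in the positive multiples of some
    [d > 0].  For such a roof the height modulo [d] is a well defined eigenfunction
    on the suspension: the open set of points of height in (0, d/2) modulo [d]
    comes back to itself, hence misses the one of heights in (d/2, d), at all
    times [n * d]. *)

Import Order.TTheory GRing.Theory Num.Theory.
Import numFieldNormedType.Exports.
Local Open Scope ring_scope.

(** * Cylinders as a neighbourhood base *)

Section Cylinders.
Context {R : realType} {A : finType}.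
Implicit Types x y z : fullshift R A.

Definition cylinder (m : nat) (x : fullshift R A) : set (fullshift R A) :=
  [set y | forall n : int, (absz n < m)%N -> x n = y n].

Lemma cylinder_refl m x : cylinder m x x.
Proof. by []. Qed.

Lemma cylinder_sym m x y : cylinder m x y -> cylinder m y x.
Proof. by move=> xy n /xy. Qed.

Lemma cylinder_trans m y x z : cylinder m x y -> cylinder m y z -> cylinder m x z.
Proof. by move=> xy yz n nm; rewrite xy// yz. Qed.

Lemma cylinder_le m k x : (m <= k)%N -> cylinder k x `<=` cylinder m x.
Proof. by move=> mk y xy n nm; rewrite xy//; exact: leq_trans mk. Qed.

(** By [shift_dist_leP], [cylinder m x] is the closed ball of radius [2 ^- m] around [x]. *)
Lemma nbhs_cylinder (x : fullshift R A) (S : set (fullshift R A)) :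
  nbhs x S <-> exists m, cylinder m x `<=` S.
Proof.
split=> [/nbhs_ballP[e /= e0 xeS]|[m xmS]].
  have [m _ /(_ _ (leqnn m))/= me] := near_infty_natSinv_expn_lt (PosNum e0).
  exists m => y /shift_dist_leP xy; apply: xeS; rewrite ballEmdist/=.
  by rewrite (le_lt_trans xy)// -div1r.
apply/nbhs_ballP; exists (2 ^- m); first by rewrite /= invr_gt0 exprn_gt0.
by move=> y; rewrite ballEmdist/= => /ltW /shift_dist_leP xy; exact: xmS.
Qed.

End Cylinders.

(** * Compactness and uniform continuity on a shift space *)

Section ShiftSpace.
Context {R : realType} {A : finType} (X : shift_space R A).

Lemma nbhs_shift_space_cylinder (x : X) (S : set X) :
  nbhs x S <-> exists m, forall y : X, cylinder m (val x) (val y) -> S y.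
Proof.
split=> [[_ [[B Bo <-] Bx BS]]|[m xmS]].
  have /nbhs_cylinder[m mB] : nbhs (val x) B by exact: open_nbhs_nbhs.
  by exists m => y /mB By; exact: BS.
have xm : nbhs (set_val x) (cylinder m (val x)) by apply/nbhs_cylinder; exists m.
have : nbhs x (set_val @^-1` cylinder m (val x)).
  exact: (@initial_continuous X _ set_val x _ xm).
by apply: filterS => y; exact: xmS.
Qed.

(** An ultrafilter settles on one letter at each coordinate; these letters form its limit, which
    lies in [X] because [X] is closed. *)
Lemma shift_space_compact : compact [set: X].
Proof.
rewrite compact_ultra => F FU _.
have FP : ProperFilter F := @ultra_proper _ _ FU.
have coord (n : int) : exists a, F [set y : X | val y n = a].
  (* Otherwise [F] contains the complement of each of the finitely many letter sets, whose
     intersection is empty. *)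
  apply: contrapT => /forallNP nF.
  have FN a : F [set y : X | val y n <> a].
    by have [/nF//|] := in_ultra_setVsetC [set y : X | val y n = a] FU.
  by have [y /(_ (val y n))] := filter_ex (filter_forall _ FN).
have [x Fx] := choice coord.
have Fcyl m : F [set y : X | cylinder m x (val y)].
  elim: m => [|m IH]; first by apply: filterS filterT => y _ n.
  move: IH (Fx m%:Z) (Fx (- m%:Z)); apply: filterS3 => y /= xy yp yn n.
  rewrite ltnS leq_eqVlt => /predU1P[nm|/xy//].
  by have [->|->] : n = m%:Z \/ n = - m%:Z by lia.
have Xx : shift_set X x.
  rewrite [shift_set X](closure_id _).1; last exact: shift_set_closed.
  move=> B /nbhs_cylinder[m mB]; have [y xy] := filter_ex (Fcyl m).
  by exists (val y); split; [apply: set_mem; exact: valP|exact: mB].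
exists (exist _ x (mem_set Xx)); split=> // B /nbhs_shift_space_cylinder[m mB].
by apply: filterS (Fcyl m) => y; exact: mB.
Qed.

Lemma uniform_cylinder (r : X -> R) (e : R) : continuous r -> 0 < e ->
  exists m, forall x y : X, cylinder m (val x) (val y) -> `|r x - r y| < e.
Proof.
move=> rc e0.
pose P (m : nat) (x : X) :=
  forall y : X, cylinder m (val x) (val y) -> `|r x - r y| < e.
have : \forall m \near \oo, [set: X] `<=` P m.
  apply: ((compact_near_coveringP _).1 shift_space_compact) => x _.
  have e20 : 0 < e / 2 by rewrite divr_gt0.
  have /cvgrPdist_lt/(_ _ e20)/nbhs_shift_space_cylinder[m xm] := rc x.
  exists ([set y : X | cylinder m (val x) (val y)], [set k | (m <= k)%N]).
    split; last by exists m.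
    by apply/nbhs_shift_space_cylinder; exists m.
  move=> [y k] [/= xy mk] z /(cylinder_le _ _ _ mk) yz.
  have := xm _ (cylinder_trans _ _ _ _ xy yz); have := xm _ xy => /= H1 H2.
  rewrite (_ : r y - r z = - (r x - r y) + (r x - r z)); last by ring.
  by rewrite (le_lt_trans (ler_normD _ _))// normrN; lra.
by move=> [m _ /(_ _ (leqnn m)) H]; exists m => x; exact: H.
Qed.

(** * Approximation by lattice-valued roofs *)

Lemma locally_constant_continuous (T : topologicalType) (m : nat) (f : X -> T) :
  (forall x y : X, cylinder m (val x) (val y) -> f x = f y) -> continuous f.
Proof.
move=> fm x B /nbhs_singleton Bfx.
by apply/nbhs_shift_space_cylinder; exists m => y /fm /= <-.
Qed.

(** The roof is sampled at one representative per cylinder, at a cost below [d], and rounded up to a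
    multiple of [d], at a further cost of at most [d]. Rounding to the truncated quotient plus one
    keeps the value positive. *)
Lemma lattice_roof_approx (r : X -> R) (d : R) : roof_function r -> 0 < d ->
  exists k : X -> nat, roof_function (fun x => d * (k x).+1%:R) /\
    forall x, `|r x - d * (k x).+1%:R| <= 2 * d.
Proof.
move=> [rc r0] d0; have [m rm] := uniform_cylinder r d rc d0.
have [x0 Xx0] := shift_set_nonempty X.
(* The default is a fixed point rather than [x], so that [rep x] depends only on the cylinder of
   [x]. *)
pose rep (x : X) : X :=
  xget (exist _ x0 (mem_set Xx0)) [set y : X | cylinder m (val x) (val y)].
have rep_cyl x : cylinder m (val x) (val (rep x)).
  by rewrite /rep; case: xgetP => [y _ //|/(_ x) /(_ (cylinder_refl _ _))].
have rep_eq x y : cylinder m (val x) (val y) -> rep x = rep y.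
  move=> xy; rewrite /rep.
  congr xget; apply/seteqP; split=> z /=; last exact: cylinder_trans.
  exact: cylinder_trans (cylinder_sym _ _ _ xy).
exists (fun x => Num.truncn (r (rep x) / d)); split.
  split=> [|x]; last by rewrite mulr_gt0.
  by apply: (locally_constant_continuous _ m) => x y /rep_eq ->.
move=> x; have /truncn_itv/andP[] : 0 <= r (rep x) / d.
  by rewrite divr_ge0// ltW.
rewrite ler_pdivlMr// ltr_pdivrMr// -natr1 => lo hi.
have /ltr_normlP[] := rm _ _ (rep_cyl x).
by move=> h1 h2; apply/ler_normlP; split; nra.
Qed.

(** * Failure of mixing for lattice-valued roofs *)

Section LatticeRoof.
Context (d : R) (k : X -> nat).
Hypothesis d_gt0 : 0 < d.
Let r (x : X) : R := d * (k x).+1%:R.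

Lemma lattice_roof_ge x : d <= r x.
Proof. by rewrite /r ler_peMr ?ler1n// ltW. Qed.

Lemma lattice_roof_gt0 x : 0 < r x.
Proof. exact: lt_le_trans (lattice_roof_ge x). Qed.

Lemma lattice_birkhoff_sum n x : exists z : int, birkhoff_sum r n x = d * z%:~R.
Proof.
case: n => n /=.
  exists (\sum_(j < n) (k (sigma j%:Z x)).+1%:Z).
  by rewrite rmorph_sum mulr_sumr.
exists (- \sum_(j < n.+1) (k (sigma (- j.+1%:Z) x)).+1%:Z).
by rewrite rmorphN mulrN rmorph_sum mulr_sumr.
Qed.

Lemma no_lattice_point (z : int) : ~ (0 < d * z%:~R < d).
Proof.
move=> /andP[]; rewrite pmulr_rgt0// ltr0z gtz0_ge1 => z1.
by rewrite ltNge ler_peMr ?ler1z// ltW.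
Qed.

(** The preimage in the reals of the image of [s] in the circle of length [d]. *)
Definition height_mod (s : set R) : set R :=
  [set t | exists z : int, s (t - d * z%:~R)].

Definition height_set (s : set R) : set (suspension r) :=
  [set p | exists2 a : under_roof r, p = susp_pi a & height_mod s (val a).2].

(** Glued points have heights [r x] and [0], both multiples of [d], while [s] avoids these modulo
    [d]. Hence membership does not depend on the representative. *)
Lemma height_setE (s : set R) (a : under_roof r) : s `<=` `]0, d[ ->
  height_set s (susp_pi a) <-> height_mod s (val a).2.
Proof.
move=> s0d; split=> [|?]; last by exists a.
have nlattice (z : int) : ~ height_mod s (d * z%:~R).
  move=> [w /s0d]; rewrite /= in_itv/= -mulrBr -rmorphB/=.
  exact: no_lattice_point.
have nglue (u v : under_roof r) : Defs.glue u v ->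
    ~ height_mod s (val u).2 /\ ~ height_mod s (val v).2.
  move=> [-> ->] /=; split; first exact: (nlattice (k (val u).1).+1%:Z).
  by rewrite -(mulr0 d); exact: (nlattice 0).
move=> [b /susp_piP [|<-//|/nglue[]|/nglue[]]//]; exact: lattice_roof_gt0.
Qed.

Lemma height_set_open (s : set R) : s `<=` `]0, d[ -> open s ->
  open (height_set s).
Proof.
move=> s0d so; rewrite /open/= /quotient_open.
have -> : \pi_(suspension r)%qT @^-1` height_set s =
          (fun a : under_roof r => (val a).2) @^-1` height_mod s.
  by apply/seteqP; split=> a /(height_setE _ a s0d).
apply: open_comp => [a _|].
  apply: (@continuous_comp _ _ _ (@set_val _ (under_roof r)) snd).
    exact: initial_continuous.
  exact: cvg_snd.
have -> : height_mod s = \bigcup_z (fun t => t - d * z%:~R) @^-1` s.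
  by apply/seteqP; split=> [t [z ?]|t [z _ ?]]; exists z.
apply: bigcup_open => z _; apply: open_comp so => t _.
by apply: cvgB; [exact: cvg_id|exact: cvg_cst].
Qed.

Lemma height_set_nonempty (s : set R) : s `<=` `]0, d[ -> s !=set0 ->
  height_set s !=set0.
Proof.
move=> s0d [t st]; have [x Xx] := shift_set_nonempty X.
have /andP[t0 td] : 0 < t < d by have := s0d _ st; rewrite /= in_itv.
have ta : ((exist _ x (mem_set Xx) : X), t) \in under_roof r.
  apply: mem_set; split=> /=; first exact: ltW.
  exact: ltW (lt_le_trans td (lattice_roof_ge _)).
exists (susp_pi (exist (fun p => p \in under_roof r) _ ta)).
by apply/height_setE => //=; exists 0; rewrite mulr0 subr0.
Qed.

(** Flowing for time [d * n] changes the height by [d * n] minus a Birkhoff sum, which is a multiple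
    of [d]. *)
Lemma height_set_flow (s : set R) (n : nat) (p : suspension r) :
  s `<=` `]0, d[ -> height_set s p -> height_set s (suspension_flow (d * n%:R) p).
Proof.
(* The lower bound [d] on the roof ensures that [suspension_flow] does not return its default
   value. *)
move=> s0d; have /(suspension_flowP lattice_roof_gt0 _ _ _ d_gt0 lattice_roof_ge) :=
  erefl (suspension_flow (d * n%:R) p).
move=> [a [b [m [-> -> _ E]]]] /height_setE-/(_ s0d)[z sz].
apply/height_setE => //; have [w wE] := lattice_birkhoff_sum m (val a).1.
exists (z + n%:Z - w); congr (s _): sz.
by rewrite rmorphB rmorphD/= -[n%:Z%:~R]/(n%:R); move: E; rewrite wE; lra.
Qed.

Lemma lattice_roof_not_mixing : ~ topologically_mixing (@suspension_flow R A X r).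
Proof.
have d4 : 0 < d / 4 < d / 2 by have := d_gt0; lra.
have d34 : d / 2 < 3 * d / 4 < d by have := d_gt0; lra.
have lo : `]0, d / 2[ `<=` `]0, d[.
  by move=> t /=; rewrite !in_itv/= => /andP[]; lra.
have hi : `]d / 2, d[ `<=` `]0, d[.
  by move=> t /=; rewrite !in_itv/= => /andP[]; lra.
move=> /(_ _ _ (height_set_open _ lo _) (height_set_nonempty _ lo _)
           (height_set_open _ hi _) (height_set_nonempty _ hi _)) [].
- exact: interval_open.
- by exists (d / 4); rewrite /= in_itv.
- exact: interval_open.
- by exists (3 * d / 4); rewrite /= in_itv.
(* This [n] makes [d * n] a return time beyond [T]. *)
move=> T mix; pose n := Num.bound `|T / d|.
have [|q [[p + <-]]] := mix (d * n%:R).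
  rewrite mulrC -ler_pdivrMr// (le_trans (ler_norm _))// ltW//.
  exact: archi_boundP.
move=> /(height_set_flow _ n _ lo)[a -> [z /= az]] /height_setE-/(_ hi)[w /= aw].
move: az aw; rewrite !in_itv/= => /andP[az1 az2] /andP[aw1 aw2].
(* The same height lies in []0, d / 2[] after subtracting [d * z] and in []d / 2, d[] after
   subtracting [d * w]; the difference of the two residues is a multiple of [d] strictly between [0]
   and [d]. *)
have : 0 < d * (z - w)%:~R < d by rewrite rmorphB/= mulrBr; lra.
exact: no_lattice_point.
Qed.

End LatticeRoof.
End ShiftSpace.

Theorem theorem3p11 (R : realType) (A : finType) (X : shift_space R A) :
  sup_dense
    [set r : X -> R | roof_function r /\
                      ~ topologically_mixing (@suspension_flow R A X r)]
    [set r : X -> R | roof_function r].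
Proof.
split=> [r [] //|r rroof e e0].
(* The approximation error is twice the mesh, and [2 * (e / 3) < e]. *)
have d0 : 0 < e / 3 by rewrite divr_gt0.
have [k [kroof rk]] := lattice_roof_approx X r (e / 3) rroof d0.
exists (fun x => e / 3 * (k x).+1%:R).
  by split=> //; exact: lattice_roof_not_mixing.
apply: (@le_lt_trans _ _ (2 * (e / 3))); last by lra.
apply: ge_sup; last by move=> _ [x _ <-]; exact: rk.
(* Bounding the supremum by an upper bound requires a nonempty range. *)
have [x Xx] := shift_set_nonempty X.
by eexists; exists (exist _ x (mem_set Xx)).
Qed.
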